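(* Let $\mathcal H$ be a real separable Hilbert space with $\dim\mathcal H=\infty$, let $(b_k)_{k\in\mathbb N}$ be an orthonormal basis of $\ell^2(\mathbb R)$, and let $A\in L(\ell^2(\mathbb R))$ be a bounded linear operator. Then $$\ell^2(\mathcal H)\ni f\longmapsto \tilde A f:=\sum_{k=1}^\infty[f,b_k]\bullet Ab_k\in\ell^2(\mathcal H)$$ is a well-defined bounded linear operator on $\ell^2(\mathcal H)$ with $\|\tilde A\|_{L(\ell^2(\mathcal H))}=\|A\|_{L(\ell^2(\mathbb R))}$. Moreover $\tilde A$ does not depend on the particular choice of the orthonormal basis $(b_k)_{k\in\mathbb N}$ of $\ell^2(\mathbb R)$.
   Context: $\ell^2(\mathcal H)$ is the Hilbert space of sequences $f=(f_k)_{k\in\mathbb N}$ in $\mathcal H$ with $\sum_{k=1}^\infty\|f_k\|_{\mathcal H}^2<\infty$, with inner product $(f,g)_{\ell^2(\mathcal H)}=\sum_{k=1}^\infty(f_k,g_k)_{\mathcal H}$. For $h\in\mathcal H$, $x\in\ell^2(\mathbb R)$ and $f\in\ell^2(\mathcal H)$ put $h\bullet x:=(x_kh)_{k\in\mathbb N}\in\ell^2(\mathcal H)$ and $[f,x]:=\sum_{k=1}^\infty x_kf_k\in\mathcal H$ (the series converges in $\mathcal H$). $L(X)$ denotes the bounded linear operators on $X$. *)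

(* Defs.v *)
From HB Require Import structures.
From mathcomp Require Import all_boot all_order all_algebra.
From mathcomp Require Import all_classical all_reals all_analysis.
From mathcomp Require Import ring lra.

Set Implicit Arguments.
Unset Strict Implicit.
Unset Printing Implicit Defensive.

Import Order.TTheory GRing.Theory Num.Theory.
Import numFieldNormedType.Exports.

Local Open Scope classical_set_scope.
Local Open Scope ring_scope.

HB.mixin Record NormedModule_isInnerProduct (R : realType) V
    & NormedModule R V := {
  inner : V -> V -> R;
  innerC : forall x y, inner x y = inner y x;
  inner_linearl : forall a x y z,
    inner (a *: x + y) z = a * inner x z + inner y z;
  inner_normE : forall x, inner x x = `|x| ^+ 2
}.

#[short(type="innerProductType")]
HB.structure Definition InnerProduct (R : realType) :=
  {V of NormedModule R V & NormedModule_isInnerProduct R V}.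

#[short(type="hilbertType")]
HB.structure Definition Hilbert (R : realType) :=
  {V of InnerProduct R V & CompleteNormedModule R V}.

HB.factory Record Lmodule_isInnerProduct (R : realType) V
    & GRing.Lmodule R V := {
  inner : V -> V -> R;
  innerC : forall x y, inner x y = inner y x;
  inner_linearl : forall a x y z,
    inner (a *: x + y) z = a * inner x z + inner y z;
  inner_ge0 : forall x, 0 <= inner x x;
  inner_eq0 : forall x, inner x x = 0 -> x = 0
}.

HB.builders Context R V & Lmodule_isInnerProduct R V.

Let norm (x : V) : R := Num.sqrt (inner x x).

Let sqr_norm x : norm x ^+ 2 = inner x x.
Proof. by rewrite sqr_sqrtr// inner_ge0. Qed.

Let inner0l z : inner 0 z = 0.
Proof.
have := inner_linearl 1 0 0 z.
by rewrite scaler0 addr0 mul1r => /eqP; rewrite -subr_eq0 opprD addNKr oppr_eq0 => /eqP.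
Qed.

Let innerZl a x z : inner (a *: x) z = a * inner x z.
Proof. by rewrite -[a *: x]addr0 inner_linearl inner0l addr0. Qed.

Let innerZZ a x : inner (a *: x) (a *: x) = a ^+ 2 * inner x x.
Proof. by rewrite innerZl innerC innerZl mulrA. Qed.

Let inner_sqr a x y : inner (a *: x + y) (a *: x + y) =
  a ^+ 2 * inner x x + 2 * a * inner x y + inner y y.
Proof.
rewrite inner_linearl (innerC x) (innerC y) !inner_linearl (innerC y x).
ring.
Qed.

Let cauchy_schwarz x y : inner x y <= norm x * norm y.
Proof.
have [x0|x0] := eqVneq (inner x x) 0.
  by rewrite (inner_eq0 x0) inner0l mulr_ge0// sqrtr_ge0.
have xp : 0 < inner x x by rewrite lt_def x0 inner_ge0.
have H := inner_ge0 (- (inner x y / inner x x) *: x + y).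
rewrite inner_sqr in H.
have {}H : inner x y ^+ 2 <= inner x x * inner y y.
  rewrite -subr_ge0.
  have -> : inner x x * inner y y - inner x y ^+ 2 = inner x x *
    ((- (inner x y / inner x x)) ^+ 2 * inner x x +
     2 * - (inner x y / inner x x) * inner x y + inner y y) by field.
  by rewrite mulr_ge0// inner_ge0.
rewrite (le_trans (ler_norm _))// -ler_sqr ?nnegrE ?mulr_ge0 ?sqrtr_ge0//.
by rewrite exprMn !sqr_norm real_normK// num_real.
Qed.

Let ler_normD x y : norm (x + y) <= norm x + norm y.
Proof.
rewrite -ler_sqr ?nnegrE ?addr_ge0 ?sqrtr_ge0// sqrrD !sqr_norm.
have := inner_sqr 1 x y; rewrite scale1r expr1n mul1r mulr1 => ->.
by have := cauchy_schwarz x y; lra.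
Qed.

Let normrZ a x : norm (a *: x) = `|a| * norm x.
Proof. by rewrite /norm innerZZ sqrtrM ?sqr_ge0// sqrtr_sqr. Qed.

Let normr0_eq0 x : norm x = 0 -> x = 0.
Proof. by move=> x0; apply: inner_eq0; rewrite -sqr_norm x0 expr0n. Qed.

HB.instance Definition _ :=
  Lmodule_isNormed.Build R V ler_normD normrZ normr0_eq0.

Let inner_normE (x : V) : inner x x = `|x| ^+ 2.
Proof. by rewrite -sqr_norm. Qed.

HB.instance Definition _ :=
  NormedModule_isInnerProduct.Build R V innerC inner_linearl inner_normE.

HB.end.

Section real_line.
Context (R : realType).

Let innerC (x y : R^o) : (x * y : R) = y * x. Proof. exact: mulrC. Qed.

Let inner_linearl (a : R) (x y z : R^o) :
  ((a *: x + y) * z : R) = a * (x * z) + y * z.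
Proof. by rewrite mulrDl mulrA. Qed.

Let inner_normE (x : R^o) : (x * x : R) = `|x| ^+ 2.
Proof. by rewrite real_normK// num_real. Qed.

HB.instance Definition _ :=
  NormedModule_isInnerProduct.Build R R^o innerC inner_linearl inner_normE.

End real_line.

Section inner_theory.
Context {R : realType} {V : innerProductType R}.
Implicit Types x y z : V.

Lemma inner0l z : inner 0 z = 0.
Proof.
have := inner_linearl 1 0 0 z.
by rewrite scaler0 addr0 mul1r => /eqP; rewrite -subr_eq0 opprD addNKr oppr_eq0 => /eqP.
Qed.

Lemma innerDl x y z : inner (x + y) z = inner x z + inner y z.
Proof. by rewrite -[x]scale1r inner_linearl scale1r mul1r. Qed.

Lemma innerZl a x z : inner (a *: x) z = a * inner x z.
Proof. by rewrite -[a *: x]addr0 inner_linearl inner0l addr0. Qed.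

Lemma innerDr x y z : inner z (x + y) = inner z x + inner z y.
Proof. by rewrite innerC innerDl !(innerC z). Qed.

Lemma innerZr a x z : inner z (a *: x) = a * inner z x.
Proof. by rewrite innerC innerZl (innerC z). Qed.

Lemma normD_sqr x y : `|x + y| ^+ 2 = `|x| ^+ 2 + 2 * inner x y + `|y| ^+ 2.
Proof. by rewrite -!inner_normE innerDl !innerDr (innerC y x); ring. Qed.

Lemma normD_sqr_le x y : `|x + y| ^+ 2 <= 2 * (`|x| ^+ 2 + `|y| ^+ 2).
Proof.
have := normD_sqr x (- y); rewrite -scaleN1r innerZr normrZ normrN1 mul1r.
by rewrite (normD_sqr x y); have := sqr_ge0 `|x + -1 *: y|; lra.
Qed.

Lemma inner_le_sqr x y : `|inner x y| <= `|x| ^+ 2 + `|y| ^+ 2.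
Proof.
have := normD_sqr x y; have := sqr_ge0 `|x + y|.
have := normD_sqr x (- y); rewrite -scaleN1r innerZr normrZ normrN1 mul1r.
have := sqr_ge0 `|x + -1 *: y|.
have := sqr_ge0 `|x|; have := sqr_ge0 `|y|.
by rewrite ler_norml => *; apply/andP; split; lra.
Qed.

End inner_theory.

Definition square_summable (R : realType) (H : normedModType R)
  (f : nat -> H) : Prop := cvgn (series (fun k => `|f k| ^+ 2)).

Definition square_summables (R : realType) (H : normedModType R) :
  {pred nat -> H} := [pred f | `[< square_summable f >]].

Section square_summable_closed.
Context {R : realType} {H : innerProductType R}.
Implicit Types f g : nat -> H.

Lemma square_summable0 : square_summable (0 : nat -> H).
Proof.
rewrite /square_summable.
have -> : series (fun k => `|(0 : nat -> H) k| ^+ 2) = cst 0 :> (nat -> R).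
  by apply/funext => n; rewrite /series/= big1// => k _; rewrite normr0 expr0n.
exact: is_cvg_cst.
Qed.

Lemma square_summableD f g :
  square_summable f -> square_summable g -> square_summable (f + g).
Proof.
move=> sf sg.
have /(@is_cvg_seriesZ _ _ 2) := is_cvg_seriesD sf sg.
apply: series_le_cvg => k /=; first exact: sqr_ge0.
- by rewrite mulr_ge0// addr_ge0// sqr_ge0.
- exact: normD_sqr_le.
Qed.

Lemma square_summableZ a f : square_summable f -> square_summable (a *: f).
Proof.
move=> /(@is_cvg_seriesZ _ _ (`|a| ^+ 2)).
apply: series_le_cvg => k /=; first exact: sqr_ge0.
- by rewrite mulr_ge0// sqr_ge0.
- by rewrite normrZ exprMn.
Qed.

Lemma square_summable_submod_closed :
  submod_closed (@square_summables R H).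
Proof.
split; first exact/asboolP/square_summable0.
move=> a f g /asboolP sf /asboolP sg.
by apply/asboolP/square_summableD => //; exact: square_summableZ.
Qed.

HB.instance Definition _ := GRing.isSubmodClosed.Build R (nat -> H)
  (@square_summables R H) square_summable_submod_closed.

End square_summable_closed.

Record ell2 (R : realType) (H : innerProductType R) := Ell2 {
  ell2_seq :> nat -> H ;
  _ : ell2_seq \in @square_summables R H
}.

Section ell2_inner.
Context {R : realType} {H : innerProductType R}.

HB.instance Definition _ := [isSub for @ell2_seq R H].
HB.instance Definition _ := [Choice of ell2 H by <:].
HB.instance Definition _ := [SubChoice_isSubLmodule of ell2 H by <:].

Implicit Types f g h : ell2 H.

Lemma ell2P f : square_summable f.
Proof. exact/asboolP/(valP f). Qed.
Arguments ell2P : clear implicits.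

Lemma ell2_ext f g : (forall k, f k = g k) -> f = g.
Proof. by move=> fg; apply/val_inj/funext. Qed.

Lemma ell2_addE f g k : (f + g) k = f k + g k. Proof. by []. Qed.

Lemma ell2_scaleE a f k : (a *: f) k = a *: f k. Proof. by []. Qed.

Lemma ell2_subE f g k : (f - g) k = f k - g k. Proof. by []. Qed.

Definition ell2_inner f g : R := limn (series (fun k => inner (f k) (g k))).

Lemma is_cvg_ell2_inner f g : cvgn (series (fun k => inner (f k) (g k))).
Proof.
apply: (@normed_cvg _ R^o).
have := is_cvg_seriesD (ell2P f) (ell2P g).
apply: series_le_cvg => k //=; first by rewrite addr_ge0// sqr_ge0.
exact: inner_le_sqr.
Qed.
Arguments is_cvg_ell2_inner : clear implicits.

Let ell2_innerC f g : ell2_inner f g = ell2_inner g f.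
Proof.
congr (limn (series _)); apply/funext => k; exact: innerC.
Qed.

Let ell2_inner_linearl a f g h :
  ell2_inner (a *: f + g) h = a * ell2_inner f h + ell2_inner g h.
Proof.
have fh := @is_cvg_seriesZ _ _ a (is_cvg_ell2_inner f h).
have gh := is_cvg_ell2_inner g h.
rewrite /ell2_inner -[a * _](lim_seriesZ _ (is_cvg_ell2_inner f h)).
rewrite -(lim_seriesD fh gh); congr (limn (series _)); apply/funext => k.
exact: inner_linearl.
Qed.

Let ell2_inner_partial f n :
  \sum_(0 <= k < n) `|f k| ^+ 2 <= ell2_inner f f.
Proof.
have -> : ell2_inner f f = limn (series (fun k => `|f k| ^+ 2)).
  by congr (limn (series _)); apply/funext => k; exact: inner_normE.
apply: (nondecreasing_cvgn_le _ (ell2P f)).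
by apply: nondecreasing_series => k _ _; exact: sqr_ge0.
Qed.

Let ell2_inner_ge0 f : 0 <= ell2_inner f f.
Proof. by have := ell2_inner_partial f 0; rewrite big_geq. Qed.

Let ell2_inner_eq0 f : ell2_inner f f = 0 -> f = 0.
Proof.
move=> f0; apply: ell2_ext => k.
have := ell2_inner_partial f k.+1.
rewrite f0 big_nat_recr//= => fk.
have : `|f k| ^+ 2 <= 0.
  by rewrite (le_trans _ fk)// lerDr sumr_ge0// => i _; exact: sqr_ge0.
by rewrite le_eqVlt ltNge sqr_ge0 orbF sqrf_eq0 normr_eq0 => /eqP.
Qed.

HB.instance Definition _ := Lmodule_isInnerProduct.Build R (ell2 H)
  ell2_innerC ell2_inner_linearl ell2_inner_ge0 ell2_inner_eq0.

Lemma ell2_innerE f g :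
  inner f g = limn (series (fun k => inner (f k) (g k))).
Proof. by []. Qed.

Lemma ell2_normE f : `|f| ^+ 2 = limn (series (fun k => `|f k| ^+ 2)).
Proof.
rewrite -inner_normE ell2_innerE.
by congr (limn (series _)); apply/funext => k; exact: inner_normE.
Qed.

Lemma ell2_partial_le f n : \sum_(0 <= k < n) `|f k| ^+ 2 <= `|f| ^+ 2.
Proof. by rewrite -inner_normE; exact: ell2_inner_partial. Qed.

Lemma ell2_norm_coord f k : `|f k| <= `|f|.
Proof.
rewrite -ler_sqr ?nnegrE// (le_trans _ (ell2_partial_le f k.+1))//.
by rewrite big_nat_recr//= lerDr sumr_ge0// => i _; exact: sqr_ge0.
Qed.

End ell2_inner.

Arguments ell2P {R H} f.
Arguments is_cvg_ell2_inner {R H} f g.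

Section ell2_complete.
Context {R : realType} {H : hilbertType R}.

Lemma square_summable_bounded (f : nat -> H) (M : R) :
  (forall n, \sum_(0 <= k < n) `|f k| ^+ 2 <= M) -> square_summable f.
Proof.
move=> fM; apply: nondecreasing_is_cvgn.
  by apply: nondecreasing_series => k _ _; exact: sqr_ge0.
by exists M => _ [n _ <-]; exact: fM.
Qed.

Lemma ell2_norm_le (f : ell2 H) (M : R) : 0 <= M ->
  (forall n, \sum_(0 <= k < n) `|f k| ^+ 2 <= M ^+ 2) -> `|f| <= M.
Proof.
move=> M0 fM; rewrite -ler_sqr ?nnegrE// ell2_normE.
by apply: limr_le; [exact: ell2P|exact: nearW].
Qed.

Lemma ell2_complete (F : set_system (ell2 H)) :
  ProperFilter F -> cauchy F -> cvg F.
Proof.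
move=> FF /cauchyP Fc.
have Fdist e : 0 < e ->
    exists2 A, F A & forall f g, A f -> A g -> `|f - g| <= e.
  move=> e0; have [f0 Ff0] := Fc (e / 2) (divr_gt0 e0 (ltr0n _ 2)).
  exists (ball f0 (e / 2)) => // f g.
  rewrite -ball_normE/= => f0f f0g; rewrite [e]splitr.
  have -> : f - g = (f0 - g) - (f0 - f).
    by rewrite opprB [RHS]addrC subrKA.
  by rewrite (le_trans (ler_normB _ _))// lerD// ltW.
have Fk k : cvg ((fun f : ell2 H => f k) @ F).
  apply/cauchy_cvgP/cauchy_exP => e e0.
  have [f0 Ff0] := Fc e e0.
  exists (f0 k); change (F [set f : ell2 H | ball (f0 k) e (f k)]).
  apply: filterS Ff0 => f /=.
  rewrite -!ball_normE/= => f0f; apply: le_lt_trans f0f.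
  exact: (ell2_norm_coord (f0 - f) k).
pose g k := lim ((fun f : ell2 H => f k) @ F).
have Fg k : (fun f : ell2 H => f k) @ F --> g k by exact: Fk.
have Fbound e : 0 < e -> exists2 A, F A & forall f, A f ->
    forall n, \sum_(0 <= k < n) `|f k - g k| ^+ 2 <= e ^+ 2.
  move=> e0; have [A FA AA] := Fdist e e0.
  exists A => // f Af n.
  apply: (@cvgr_to_le _ F _ R
      (fun f' : ell2 H => \sum_(0 <= k < n) `|f k - f' k| ^+ 2)).
  - apply: cvg_big => [|k _]; [exact: add_continuous|rewrite expr2].
    under eq_fun do rewrite expr2.
    by apply: cvgM; apply: cvg_norm; apply: cvgB => //; exact: cvg_cst.
  - apply: filterS FA => f' Af'.
    rewrite (le_trans (ell2_partial_le (f - f') n))//.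
    by rewrite ler_sqr ?nnegrE ?(ltW e0)//; exact: AA.
have [A FA Ag] := Fbound 1 ltr01.
have [f0 Af0] := filter_ex FA.
have gs : square_summable g.
  have -> : g = (f0 : nat -> H) - (fun k => f0 k - g k).
    by apply/funext => k; rewrite !fctE opprB addrC subrK.
  rewrite -scaleN1r; apply: square_summableD; first exact: ell2P.
  apply: square_summableZ; apply: square_summable_bounded; exact: Ag.
apply/cvg_ex; exists (Ell2 (introT (asboolP _) gs)).
apply/cvgrPdist_le => e e0; have [B FB Bg] := Fbound e e0.
apply: filterS FB => f Bf; rewrite distrC.
by apply: ell2_norm_le => [|n]; [exact: ltW|exact: Bg].
Qed.

HB.instance Definition _ := Uniform_isComplete.Build (ell2 H) ell2_complete.

End ell2_complete.

Section bullet_bracket.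
Context {R : realType} {H : hilbertType R}.

Lemma bullet_subproof (h : H) (x : ell2 R^o) :
  (fun k => (x k : R) *: h) \in @square_summables R H.
Proof.
apply/asboolP; have := @is_cvg_seriesZ _ _ (`|h| ^+ 2) (ell2P x).
apply: series_le_cvg => k /=; first exact: sqr_ge0.
- by rewrite mulr_ge0// sqr_ge0.
- by rewrite normrZ exprMn mulrC.
Qed.

Definition bullet (h : H) (x : ell2 R^o) : ell2 H := Ell2 (bullet_subproof h x).

Lemma is_cvg_bracket (f : ell2 H) (x : ell2 R^o) :
  cvgn (series (fun k => (x k : R) *: f k)).
Proof.
apply: normed_cvg; have := is_cvg_seriesD (ell2P x) (ell2P f).
apply: series_le_cvg => k //=; first by rewrite addr_ge0// sqr_ge0.
rewrite normrZ !fctE.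
have := sqr_ge0 (`|x k| - `|f k|).
have := sqr_ge0 `|x k|; have := sqr_ge0 `|f k|.
by rewrite sqrrB; lra.
Qed.

Definition bracket (f : ell2 H) (x : ell2 R^o) : H :=
  limn (series (fun k => (x k : R) *: f k)).

End bullet_bracket.

Definition separable_space (T : topologicalType) : Prop :=
  exists2 D : set T, countable D & dense D.

Definition infinite_dimensional (R : realType) (V : lmodType R) : Prop :=
  ~ exists (n : nat) (e : 'I_n -> V),
      forall x : V, exists c : 'I_n -> R, x = \sum_(i < n) c i *: e i.

Definition orthonormal_basis (R : realType) (V : innerProductType R)
    (b : nat -> V) : Prop :=
  (forall i j, inner (b i) (b j) = (i == j)%:R) /\
  dense [set x | exists n (c : nat -> R), x = \sum_(k < n) c k *: b k].

Definition bounded_operator (R : realType) (V W : normedModType R)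
    (T : V -> W) : Prop :=
  linear T /\ exists M : R, forall x, `|T x| <= M * `|x|.

(* [sup] is 0 on sets that are not bounded above, so this is the operator norm
   only for [T] satisfying [bounded_operator]. *)
Definition opnorm (R : realType) (V W : normedModType R) (T : V -> W) : R :=
  sup [set `|T x| | x in [set x : V | `|x| <= 1]].

Section lift.
Context {R : realType} {H : hilbertType R}.
Context (b : nat -> ell2 R^o) (A : ell2 R^o -> ell2 R^o).

Definition lift_term (f : ell2 H) (k : nat) : ell2 H :=
  bullet (bracket f (b k)) (A (b k)).

Definition lift_operator (f : ell2 H) : ell2 H := limn (series (lift_term f)).

End lift.

(* Main.v *)
(* The tensor products [bullet h x] satisfy [(h.x, g.y) = (h, g)(x, y)], and the
   bracket is the adjoint of [bullet]. Hence the vectors [[f, b_k].b_k] are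
   orthogonal projections of [f] and Bessel's inequality gives
   [sum_k |[f, b_k]|^2 <= |f|^2], while a finite sum [sum_k h_k.(A b_k)] has
   squared norm [sum_ij (h_i, h_j)(A b_i, A b_j)], at most
   [|A|^2 sum_k |h_k|^2] because the Gram matrix of the [h_k] is positive
   semidefinite. Together these give convergence of the series and the upper
   bound for its norm. The lower bound comes from [lift (h.x) = h.(A x)].
   Writing [<f, h>] for the sequence [(f_k, h)], one has
   [(lift f, h.x) = (A <f, h>, x)], where the basis no longer occurs. *)

Require Import Defs.
From HB Require Import structures.
From mathcomp Require Import all_boot all_order all_algebra.
From mathcomp Require Import all_classical all_reals all_analysis.
From mathcomp Require Import ring lra.

Set Implicit Arguments.
Unset Strict Implicit.
Unset Printing Implicit Defensive.

Import Order.TTheory GRing.Theory Num.Theory.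
Import numFieldNormedType.Exports.

Local Open Scope classical_set_scope.
Local Open Scope ring_scope.

(** * Inner product spaces: continuity of the inner product, Bessel, orthonormal expansion *)

Section inner_product.
Context {R : realType} {V : innerProductType R}.
Implicit Types x y z : V.

Lemma inner0r x : inner x 0 = 0.
Proof. by rewrite innerC inner0l. Qed.

Lemma innerNl x y : inner (- x) y = - inner x y.
Proof. by rewrite -scaleN1r innerZl mulN1r. Qed.

Lemma innerBl x y z : inner (x - y) z = inner x z - inner y z.
Proof. by rewrite innerDl innerNl. Qed.

Lemma innerBr x y z : inner z (x - y) = inner z x - inner z y.
Proof. by rewrite !(innerC z) innerBl. Qed.

Lemma inner_suml (I : Type) (s : seq I) (P : pred I) (F : I -> V) y :
  inner (\sum_(i <- s | P i) F i) y = \sum_(i <- s | P i) inner (F i) y.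
Proof.
by elim/big_rec2: _ => [|i u v _ <-]; rewrite ?inner0l ?innerDl.
Qed.

Lemma inner_sumr (I : Type) (s : seq I) (P : pred I) (F : I -> V) y :
  inner y (\sum_(i <- s | P i) F i) = \sum_(i <- s | P i) inner y (F i).
Proof. by rewrite innerC inner_suml; apply: eq_bigr => i _; rewrite innerC. Qed.

(** The triangle inequality comes with the norm; squaring it leaves the bound on [inner u v], and
    the sign is absorbed by [- x]. *)
Lemma cauchy_schwarz x y : `|inner x y| <= `|x| * `|y|.
Proof.
suff H (u v : V) : inner u v <= `|u| * `|v|.
  by rewrite ler_norml H andbT lerNl -innerNl -(normrN x) H.
have : `|u + v| ^+ 2 <= (`|u| + `|v|) ^+ 2.
  by rewrite ler_sqr ?nnegrE ?addr_ge0// ler_normD.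
by rewrite normD_sqr sqrrD; lra.
Qed.

(** Polarization writes the inner product through norms, which are continuous. *)
Lemma cvg_innerl (T : Type) (F : set_system T) {FF : Filter F} (u : T -> V) x y :
  u @ F --> x -> (fun t => inner (u t) y) @ F --> inner x y.
Proof.
have polar z : inner z y = 2^-1 * (`|z + y| * `|z + y| - `|z| * `|z| - `|y| * `|y|).
  by rewrite -!expr2 normD_sqr; lra.
move=> ux; rewrite polar; under eq_fun do rewrite polar.
apply: cvgM; first exact: cvg_cst.
by apply: cvgB; [apply: cvgB; apply: cvgM; apply: cvg_norm => // | exact: cvg_cst];
  apply: cvgD => //; exact: cvg_cst.
Qed.

Lemma limn_innerl (u : nat -> V) y : cvgn u ->
  limn (fun n => inner (u n) y) = inner (limn u) y.
Proof. by move=> cu; apply/cvg_lim => //; exact: cvg_innerl. Qed.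

(* [inner x (w i) = `|w i| ^+ 2] says that [w i] is the projection of [x] on
   the line of [w i]. *)
Lemma bessel_eq (w : nat -> V) x n :
  (forall i j, i != j -> inner (w i) (w j) = 0) ->
  (forall i, inner x (w i) = `|w i| ^+ 2) ->
  `|x - \sum_(0 <= k < n) w k| ^+ 2 =
  `|x| ^+ 2 - \sum_(0 <= k < n) `|w k| ^+ 2.
Proof.
move=> ww xw; set s := \sum_(0 <= k < n) w k.
have xs : inner x s = \sum_(0 <= k < n) `|w k| ^+ 2.
  by rewrite inner_sumr; apply: eq_bigr => i _.
have ss : `|s| ^+ 2 = \sum_(0 <= k < n) `|w k| ^+ 2.
  rewrite -inner_normE inner_suml /s !big_mkord; apply: eq_bigr => i _.
  rewrite inner_sumr (bigD1 i)//= inner_normE big1 ?addr0// => j ji.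
  by rewrite ww// eq_sym.
by rewrite normD_sqr normrN innerC innerNl innerC xs ss; lra.
Qed.

Lemma bessel_le (w : nat -> V) x n :
  (forall i j, i != j -> inner (w i) (w j) = 0) ->
  (forall i, inner x (w i) = `|w i| ^+ 2) ->
  \sum_(0 <= k < n) `|w k| ^+ 2 <= `|x| ^+ 2.
Proof. by move=> ww xw; rewrite -subr_ge0 -bessel_eq// sqr_ge0. Qed.

(** Density gives a finite combination [y] within [e] of [x]. Long partial sums fix [y], so the
    remainder of [x] is that of [x - y], which [bessel_eq] bounds by the norm of [x - y]. *)
Lemma orthonormal_expansion (b : nat -> V) x : orthonormal_basis b ->
  (fun n => \sum_(0 <= k < n) inner x (b k) *: b k) @ \oo --> x.
Proof.
move=> [bb bD]; apply/cvgrPdist_lt => e e0.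
have [y [xy [n [c yE]]]] : ball x e `&`
    [set x | exists n (c : nat -> R), x = \sum_(k < n) c k *: b k] !=set0.
  by apply: bD; [exists x; exact: ballxx | exact: ball_open].
move: xy; rewrite -ball_normE/= => xy.
near=> m.
have nm : (n <= m)%N by near: m; exact: nbhs_infty_ge.
apply: le_lt_trans xy.
have yE' : \sum_(0 <= k < m) inner y (b k) *: b k = y.
  have yb k : inner y (b k) = if (k < n)%N then c k else 0.
    rewrite yE inner_suml; case: ifPn => kn.
      rewrite (bigD1 (Ordinal kn))//= innerZl bb eqxx mulr1 big1 ?addr0// => i.
      by rewrite -val_eqE/= => /negPf ik; rewrite innerZl bb ik mulr0.
    rewrite big1// => i _; rewrite innerZl bb; case: eqP => [ik|]; last by rewrite mulr0.
    by rewrite -ik ltn_ord in kn.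
  rewrite (big_cat_nat (leq0n n) nm)//= [X in _ + X]big_nat_cond [X in _ + X]big1.
    rewrite addr0 yE big_mkord; apply: eq_bigr => i _.
    by rewrite -yE yb ltn_ord.
  by move=> i /andP[/andP[ni _] _]; rewrite yb ltnNge ni scale0r.
set w := fun k => inner (x - y) (b k) *: b k.
have -> : x - \sum_(0 <= k < m) inner x (b k) *: b k =
    (x - y) - \sum_(0 <= k < m) w k.
  rewrite -{1}yE' -addrA -opprD -big_split/=; congr (_ - _).
  by apply: eq_bigr => k _; rewrite /w -scalerDl innerBl addrC subrK.
rewrite -ler_sqr ?nnegrE// bessel_eq.
- by rewrite lerBlDr lerDl sumr_ge0// => k _; exact: sqr_ge0.
- by move=> i j /negPf ij; rewrite innerZl innerZr bb ij !mulr0.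
- by move=> i; rewrite -inner_normE /w !innerZl !innerZr bb eqxx mulr1.
Unshelve. all: by end_near.
Qed.

End inner_product.

(** * Bounded operators, the operator norm and Gram matrices *)

Section bounded_operators.
Context {R : realType} {V W : normedModType R}.
Implicit Types T : V -> W.

Lemma linear_comb T (I : Type) (s : seq I) (c : I -> R) (x : I -> V) :
  linear T -> T (\sum_(i <- s) c i *: x i) = \sum_(i <- s) c i *: T (x i).
Proof.
move=> lT; pose T' : {linear V -> W} :=
  HB.pack T (GRing.isLinear.Build _ _ _ _ T lT).
by rewrite -[T]/(T' : V -> W) linear_sum; apply: eq_bigr => i _; rewrite linearZ.
Qed.

Lemma linear_fun0 T : linear T -> T 0 = 0.
Proof. by move=> /(@linear_comb T void [::] (fun=> 0) (fun=> 0)); rewrite !big_nil. Qed.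

Lemma linear_funB T x y : linear T -> T (x - y) = T x - T y.
Proof. by move=> lT; rewrite addrC -scaleN1r lT scaleN1r addrC. Qed.

Lemma linear_funZ T a x : linear T -> T (a *: x) = a *: T x.
Proof. by move=> lT; rewrite -[a *: x]addr0 lT linear_fun0// addr0. Qed.

Lemma opnorm_ub T x : bounded_operator T -> `|x| <= 1 -> `|T x| <= opnorm T.
Proof.
move=> [lT [M TM]] x1; apply: ub_le_sup; last by exists x.
(* The sign of [M] is unknown, hence the absolute value. *)
exists `|M| => _ /= [y y1 <-]; apply: le_trans (TM y) _.
by rewrite (le_trans (ler_norm _))// normrM normr_id ler_piMr.
Qed.

Lemma opnorm_ge0 T : bounded_operator T -> 0 <= opnorm T.
Proof.
by move=> bT; apply: le_trans (opnorm_ub bT (x := 0) _) => //; rewrite normr0.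
Qed.

Lemma opnorm_bound T x : bounded_operator T -> `|T x| <= opnorm T * `|x|.
Proof.
move=> bT; have [lT _] := bT.
have [->|x0] := eqVneq x 0; first by rewrite linear_fun0// !normr0 mulr0.
have nx0 : 0 < `|x| by rewrite normr_gt0.
rewrite -ler_pdivrMr// mulrC -[_^-1]ger0_norm ?invr_ge0// -normrZ.
rewrite -linear_funZ//; apply: opnorm_ub => //.
by rewrite normrZ ger0_norm ?invr_ge0// mulVf// gt_eqF.
Qed.

Lemma opnorm_le T M : 0 <= M -> (forall x, `|T x| <= M * `|x|) ->
  opnorm T <= M.
Proof.
move=> M0 TM; apply: ge_sup; first by exists `|T 0|; exists 0 => //=; rewrite normr0.
by move=> _ /= [y y1 <-]; rewrite (le_trans (TM y))// ler_piMr.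
Qed.

Lemma bounded_operator_cvg T (u : nat -> V) x : bounded_operator T ->
  u @ \oo --> x -> (T \o u) @ \oo --> T x.
Proof.
move=> Tb ux; apply/cvgrPdist_le => e e0.
have M0 := opnorm_ge0 Tb.
(* Adding 1 keeps the denominator positive when [opnorm T] is 0. *)
have d0 : 0 < e / (opnorm T + 1) by rewrite divr_gt0// ltr_wpDl.
move/cvgrPdist_le: ux => /(_ _ d0); apply: filterS => n xu /=.
rewrite -linear_funB; last by case: Tb.
apply: le_trans (opnorm_bound _ Tb) _.
apply: (@le_trans _ _ ((opnorm T + 1) * `|x - u n|)).
  by rewrite ler_wpM2r// lerDl.
by rewrite mulrC -ler_pdivlMr// ltr_wpDl.
Qed.

End bounded_operators.

(* The inequality [T^*T <= M^2] survives tensoring with any Gram matrix: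
   subtracting from every [h i] its projection onto [h a] removes [a] from
   both sides at the cost of one instance of [|T y| <= M * |y|]. *)
Lemma gram_operator_le (R : realType) (G V W : innerProductType R)
    (T : V -> W) (M : R) (I : Type) (s : seq I) (h : I -> G) (x : I -> V) :
  linear T -> (forall y, `|T y| <= M * `|y|) ->
  \sum_(i <- s) \sum_(j <- s) inner (h i) (h j) * inner (T (x i)) (T (x j)) <=
  M ^+ 2 * \sum_(i <- s) \sum_(j <- s) inner (h i) (h j) * inner (x i) (x j).
Proof.
move=> lT TM; elim: s h => [|a s IH] h; first by rewrite !big_nil mulr0.
(* If [h a = 0], division by zero gives [c i = 0] and [g i = h i], as wanted. *)
pose c i := inner (h i) (h a) / inner (h a) (h a).
pose g i := h i - c i *: h a.
have ca : (c a) *: h a = h a.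
  have [->|ha0] := eqVneq (h a) 0; first by rewrite scaler0.
  by rewrite /c divff ?scale1r// inner_normE sqrf_eq0 normr_eq0.
have ga : g a = 0 by rewrite /g ca subrr.
(* Pythagoras: each [g i] is orthogonal to [h a]. *)
have gramE i j : inner (h i) (h j) =
    inner (g i) (g j) + inner (h a) (h a) * (c i * c j).
  have ch k : c k * inner (h a) (h a) = inner (h k) (h a).
    rewrite /c; have [->|ha0] := eqVneq (h a) 0; first by rewrite !inner0r mulr0.
    by rewrite divfK// inner_normE sqrf_eq0 normr_eq0.
  rewrite /g innerBl !innerBr !innerZl !innerZr (innerC (h a) (h j)) -(ch i) -(ch j); ring.
(* [U] and [y] are generic because the identity serves for [T (x i)] in [W] and for [x i] in [V]. *)
have sumE (U : innerProductType R) (y : I -> U) :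
    \sum_(i <- a :: s) \sum_(j <- a :: s) inner (h i) (h j) * inner (y i) (y j) =
    \sum_(i <- s) \sum_(j <- s) inner (g i) (g j) * inner (y i) (y j) +
    inner (h a) (h a) * `|\sum_(i <- a :: s) c i *: y i| ^+ 2.
  transitivity (\sum_(i <- a :: s) \sum_(j <- a :: s)
      inner (g i) (g j) * inner (y i) (y j) +
    inner (h a) (h a) * `|\sum_(i <- a :: s) c i *: y i| ^+ 2).
    rewrite -inner_normE inner_suml mulr_sumr -big_split/=.
    apply: eq_bigr => i _; rewrite inner_sumr mulr_sumr -big_split/=.
    by apply: eq_bigr => j _; rewrite gramE innerZl innerZr; ring.
  congr (_ + _); rewrite big_cons big1 ?add0r => [|j _]; last first.
    by rewrite ga inner0l mul0r.
  by apply: eq_bigr => i _; rewrite big_cons ga inner0r mul0r add0r.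
rewrite !sumE mulrDr lerD ?IH// [leRHS]mulrCA ler_wpM2l ?inner_normE ?sqr_ge0//.
rewrite -linear_comb// -exprMn; set z := \sum_(i <- _) _.
(* [M * |z|] is nonnegative because it bounds [|T z|]. *)
by rewrite ler_sqr ?nnegrE// (le_trans _ (TM z)).
Qed.

(** * Elementary tensors, the bracket and slices, with their adjunctions *)

Section bullet_bracket_theory.
Context {R : realType} {H : hilbertType R}.
Implicit Types (f g : ell2 H) (h : H) (x y : ell2 R^o).

Lemma slice_subproof f h :
  (fun k => inner (f k) h : R^o) \in @square_summables R R^o.
Proof.
apply/asboolP; have := @is_cvg_seriesZ _ _ (`|h| ^+ 2) (ell2P f).
apply: series_le_cvg => k /=; first exact: sqr_ge0.
- by rewrite mulr_ge0// sqr_ge0.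
- by rewrite -[leRHS]exprMn ler_sqr ?nnegrE ?mulr_ge0// mulrC cauchy_schwarz.
Qed.

(** This is the sequence [<f, h>]; for fixed [h], the map [f |-> slice f h] is the adjoint of
    [bullet h]. *)
Definition slice f h : ell2 R^o := Ell2 (slice_subproof f h).

Lemma inner_bullet_slice h x f : inner (bullet h x) f = inner x (slice f h).
Proof.
rewrite !ell2_innerE; congr (limn (series _)); apply/funext => k /=.
by rewrite innerZl innerC.
Qed.

Lemma inner_bullet h x f : inner (bullet h x) f = inner h (bracket f x).
Proof.
rewrite ell2_innerE [RHS]innerC -limn_innerl; last exact: is_cvg_bracket.
congr (limn _); apply/funext => n.
rewrite /series/= inner_suml; apply: eq_bigr => k _.
by rewrite !innerZl innerC.
Qed.

Lemma bracket_bullet h x y : bracket (bullet h x) y = inner x y *: h.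
Proof.
apply/cvg_lim => //; rewrite /series/=.
under eq_fun do under eq_bigr do rewrite scalerA mulrC.
under eq_fun do rewrite -scaler_suml.
by apply: cvgZr_tmp; exact: is_cvg_ell2_inner.
Qed.

Lemma inner_bullet_bullet h x (g : H) y :
  inner (bullet h x) (bullet g y) = inner h g * inner x y.
Proof. by rewrite inner_bullet bracket_bullet innerZr (innerC y) mulrC. Qed.

Lemma norm_bullet h x : `|bullet h x| = `|h| * `|x|.
Proof.
apply/eqP; rewrite -(@eqrXn2 _ 2)// ?mulr_ge0// exprMn -!inner_normE.
by rewrite inner_bullet_bullet.
Qed.

Lemma bullet_linearl x : linear (bullet^~ x : H -> ell2 H).
Proof.
move=> a h g; apply: ell2_ext => k.
by rewrite ell2_addE ell2_scaleE /= scalerDr !scalerA [in LHS]mulrC.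
Qed.

Lemma bullet_linearr h : linear (bullet h : ell2 R^o -> ell2 H).
Proof.
move=> a x y; apply: ell2_ext => k.
by rewrite ell2_addE ell2_scaleE /= scalerDl scalerA.
Qed.

Lemma bullet_bounded h : bounded_operator (bullet h : ell2 R^o -> ell2 H).
Proof. by split; [exact: bullet_linearr|exists `|h| => x; rewrite norm_bullet]. Qed.

(** Linearity is inherited through the adjunction [inner_bullet], which makes the defect [h]
    orthogonal to itself. *)
Lemma bracket_linear x : linear (bracket^~ x : ell2 H -> H).
Proof.
move=> a f g; apply/eqP; rewrite -subr_eq0 -normr_eq0 -sqrf_eq0 -inner_normE.
set h := _ - _; rewrite {2}/h innerBr innerDr innerZr -!inner_bullet.
by rewrite innerDr innerZr subrr.
Qed.

(** Testing [u = f - g] against [bullet h (slice u h)] shows that every slice of [u] vanishes;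
    coordinate [k] of [slice u (u k)] is the squared norm of [u k]. *)
Lemma bullet_separates f g :
  (forall h x, inner f (bullet h x) = inner g (bullet h x)) -> f = g.
Proof.
move=> fg; apply/eqP; rewrite -subr_eq0; apply/eqP.
set u := f - g; apply: ell2_ext => k.
have u0 h : slice u h = 0.
  apply/eqP; rewrite -normr_eq0 -sqrf_eq0 -inner_normE -inner_bullet_slice.
  by rewrite innerC innerBl fg subrr.
have : slice u (u k) k = 0 by rewrite u0.
by move=> /= /eqP; rewrite inner_normE sqrf_eq0 normr_eq0 => /eqP.
Qed.

End bullet_bracket_theory.

(** * The lifted operator: convergence, norm and a formula free of the basis *)

Section lift_theory.
Context {R : realType} {H : hilbertType R}.
Context {b : nat -> ell2 R^o} {A : ell2 R^o -> ell2 R^o}.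
Hypothesis b_basis : orthonormal_basis b.
Hypothesis A_bounded : bounded_operator A.
Implicit Type f : ell2 H.

Lemma bracket_bessel f n :
  \sum_(0 <= k < n) `|bracket f (b k)| ^+ 2 <= `|f| ^+ 2.
Proof.
have [bb _] := b_basis.
have nb k : `|bullet (bracket f (b k)) (b k)| ^+ 2 = `|bracket f (b k)| ^+ 2.
  by rewrite -inner_normE inner_bullet_bullet bb eqxx mulr1 inner_normE.
under eq_bigr do rewrite -nb; apply: bessel_le => [i j /negPf ij|i].
  by rewrite inner_bullet_bullet bb ij mulr0.
by rewrite innerC inner_bullet nb inner_normE.
Qed.

(** Orthonormality reduces the double sum from [gram_operator_le] to its diagonal. A general [s]
    covers both the blocks of the Cauchy criterion and the initial segments. *)
Lemma lift_term_sum_le f (s : seq nat) : uniq s ->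
  `|\sum_(k <- s) lift_term b A f k| ^+ 2 <=
  opnorm A ^+ 2 * \sum_(k <- s) `|bracket f (b k)| ^+ 2.
Proof.
move=> us; have [bb _] := b_basis; have [lA _] := A_bounded.
have -> : `|\sum_(k <- s) lift_term b A f k| ^+ 2 = \sum_(i <- s) \sum_(j <- s)
    inner (bracket f (b i)) (bracket f (b j)) * inner (A (b i)) (A (b j)).
  rewrite -inner_normE inner_suml; apply: eq_bigr => i _; rewrite inner_sumr.
  by apply: eq_bigr => j _; rewrite inner_bullet_bullet.
apply: le_trans (gram_operator_le s _ _ lA (fun y => opnorm_bound y A_bounded)) _.
rewrite ler_wpM2l ?sqr_ge0// !big_seq ler_sum// => i si.
rewrite (bigD1_seq i)//= bb eqxx mulr1 inner_normE big1 ?addr0// => j ji.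
by rewrite bb eq_sym (negPf ji) mulr0.
Qed.

Lemma lift_cvg f : cvgn (series (lift_term b A f)).
Proof.
apply/cauchy_cvgP/cauchy_seriesP => e e0.
have M0 := opnorm_ge0 A_bounded.
have /cauchy_cvgP/cauchy_seriesP bC :
    cvgn (series (fun k => `|bracket f (b k)| ^+ 2)).
  exact/square_summable_bounded/bracket_bessel.
(* The threshold times [(opnorm A + 1) ^+ 2] is [e ^+ 2]. *)
have d0 : 0 < (e / (opnorm A + 1)) ^+ 2 by rewrite exprn_gt0// divr_gt0// ltr_wpDl.
apply: filterS (bC _ d0) => -[m n] /=.
rewrite ger0_norm ?sumr_ge0// => mn.
rewrite -ltr_sqr ?nnegrE ?(ltW e0)//.
apply: le_lt_trans (lift_term_sum_le f (iota_uniq _ _)) _.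
apply: (@le_lt_trans _ _ ((opnorm A + 1) ^+ 2 *
    \sum_(m <= k < n) `|bracket f (b k)| ^+ 2)).
  rewrite ler_wpM2r ?ler_sqr ?nnegrE ?addr_ge0 ?lerDl//.
  by rewrite sumr_ge0// => i _; exact: sqr_ge0.
by rewrite mulrC -ltr_pdivlMr ?exprn_gt0 ?ltr_wpDl// -exprVn -exprMn.
Qed.

Lemma lift_norm_le f : `|lift_operator b A f| <= opnorm A * `|f|.
Proof.
have M0 := opnorm_ge0 A_bounded.
have cn : (fun n => `|series (lift_term b A f) n|) @ \oo --> `|lift_operator b A f|.
  by apply: cvg_norm; exact: lift_cvg.
rewrite -(cvg_lim _ cn)//; apply: limr_le; first exact: (cvgP _ cn).
apply: nearW => n; rewrite -ler_sqr ?nnegrE ?mulr_ge0// exprMn.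
apply: le_trans (lift_term_sum_le f (iota_uniq _ _)) _.
by rewrite ler_wpM2l ?sqr_ge0// bracket_bessel.
Qed.

Lemma lift_linear : linear (lift_operator b A : ell2 H -> ell2 H).
Proof.
move=> a f g; apply/cvg_lim => //.
have -> : series (lift_term b A (a *: f + g)) =
    a *: series (lift_term b A f) + series (lift_term b A g).
  apply/funext => n; rewrite !fctE /series/= scaler_sumr -big_split/=.
  by apply: eq_bigr => k _; rewrite /lift_term bracket_linear bullet_linearl.
by apply: cvgD; [apply: cvgZl_tmp|]; exact: lift_cvg.
Qed.

Lemma lift_bounded : bounded_operator (lift_operator b A : ell2 H -> ell2 H).
Proof.
by split; [exact: lift_linear|exists (opnorm A) => f; exact: lift_norm_le].
Qed.

Lemma operator_expansion x :
  (fun n => \sum_(0 <= k < n) inner x (b k) *: A (b k)) @ \oo --> A x.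
Proof.
have := bounded_operator_cvg A_bounded (@orthonormal_expansion _ _ _ x b_basis).
apply: cvg_trans; apply: near_eq_cvg; apply: nearW => n.
by rewrite /= (@linear_comb _ _ _ A)//; case: A_bounded.
Qed.

(** The bracket of [bullet h x] with [b k] is [inner x (b k) *: h], so the lifted series is the
    image under the continuous map [bullet h] of the expansion of [A x]. *)
Lemma lift_bullet (h : H) x : lift_operator b A (bullet h x) = bullet h (A x).
Proof.
apply/cvg_lim => //.
have := bounded_operator_cvg (bullet_bounded h) (@operator_expansion x).
apply: cvg_trans; apply: near_eq_cvg; apply: nearW => n.
rewrite /= (@linear_comb _ _ _ (bullet h)); last exact: bullet_linearr.
apply: eq_bigr => k _; rewrite /lift_term bracket_bullet.
by rewrite (linear_funZ _ _ (bullet_linearl _)).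
Qed.

Lemma inner_lift f (h : H) x :
  inner (lift_operator b A f) (bullet h x) = inner (A (slice f h)) x.
Proof.
rewrite -limn_innerl; last exact: lift_cvg.
apply/cvg_lim => //.
have : (fun n => inner (\sum_(0 <= k < n) inner (slice f h) (b k) *: A (b k)) x)
    @ \oo --> inner (A (slice f h)) x.
  by apply: cvg_innerl; exact: operator_expansion.
apply: cvg_trans; apply: near_eq_cvg; apply: nearW => n.
rewrite !inner_suml; apply: eq_bigr => k _.
rewrite innerZl inner_bullet_bullet; congr (_ * _).
(* Both adjoints of [bullet] give the same coefficient: [bracket f (b k)] against [h] equals
   [slice f h] against [b k]. *)
by rewrite [RHS]innerC -inner_bullet inner_bullet_slice innerC.
Qed.

(** For the lower bound, [lift_bullet] gives [|h| * |A x| <= opnorm lift * |h| * |x|], where the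
    positive factor [|h|] cancels. *)
Lemma opnorm_lift : (exists h : H, h != 0) ->
  opnorm (lift_operator b A : ell2 H -> ell2 H) = opnorm A.
Proof.
move=> [h h0]; have hp : 0 < `|h| by rewrite normr_gt0.
apply/eqP; rewrite eq_le; apply/andP; split.
  by apply: opnorm_le; [exact: opnorm_ge0|exact: lift_norm_le].
apply: opnorm_le => [|x]; first exact: opnorm_ge0 lift_bounded.
rewrite -(ler_pM2l hp) -norm_bullet -lift_bullet mulrCA -norm_bullet.
exact: opnorm_bound lift_bounded.
Qed.

End lift_theory.

(** * A nonzero vector, and the assembly of the four claims *)

Lemma infinite_dimensional_neq0 (R : realType) (V : lmodType R) :
  infinite_dimensional V -> exists x : V, x != 0.
Proof.
move=> Vinf; apply: contrapT => V0; apply: Vinf.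
(* The empty family would span a zero space. *)
exists 0, (fun=> 0) => x; exists (fun=> 0); rewrite big_ord0.
by apply: contrapT => /eqP x0; apply: V0; exists x.
Qed.

Theorem theorem1p15 (R : realType) (H : hilbertType R)
    (H_separable : separable_space H) (H_infinite : infinite_dimensional H)
    (b : nat -> ell2 R^o) (b_basis : orthonormal_basis b)
    (A : ell2 R^o -> ell2 R^o) (A_bounded : bounded_operator A) :
  [/\ forall f : ell2 H, cvgn (series (lift_term b A f)),
      bounded_operator (lift_operator b A : ell2 H -> ell2 H),
      opnorm (lift_operator b A : ell2 H -> ell2 H) = opnorm A &
      forall b' : nat -> ell2 R^o, orthonormal_basis b' ->
        forall f : ell2 H, lift_operator b' A f = lift_operator b A f].
Proof.
split.
- exact: lift_cvg.
- exact: lift_bounded.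
- exact/opnorm_lift/infinite_dimensional_neq0.
(* Against [bullet h x], both lifts give [inner (A (slice f h)) x]. *)
- move=> b' b'_basis f; apply: bullet_separates => h x.
  by rewrite !inner_lift.
Qed.
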